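(* Let $q=p^e$ with $p$ an odd prime and $e\ge1$, let $m\ge3$ be odd, $D=\{x\in\mathbb{F}_{q^m}:\mathrm{Tr}_{q^m/q}(x^2)=0\}=\{d_1,\dots,d_n\}$ (so $n=q^{m-1}$), and let $\alpha$ be a generator of $\mathbb{F}_{q^m}^*$. Let $G_2$ be the $(m+1)\times n$ matrix whose first row is $(1,\dots,1)$, second row $(\mathrm{Tr}_{q^m/q}(d_j))_j$, third row $(\mathrm{Tr}_{q^m/q}(\alpha d_j)+1)_j$, and $(i+2)$-th row $(\mathrm{Tr}_{q^m/q}(\alpha^id_j))_j$ for $2\le i\le m-1$. Let $G_2'=[I_{m+1}:G_2]$ and let $\overline{\mathcal{C}_D}'$ be the code generated by $G_2'$. Then $\overline{\mathcal{C}_D}'$ has parameters $[q^{m-1}+m+1,\ m+1,\ d']$ with $d'\ge (q-1)q^{\frac{m-3}{2}}(q^{\frac{m-1}{2}}-1)+1$, and $\overline{\mathcal{C}_D}'^{\perp}$ has parameters $[q^{m-1}+m+1,\ q^{m-1},\ d'^{\perp}]$ with $2\le d'^{\perp}\le3$.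
   Context: $\mathrm{Tr}_{q^m/q}$ is the trace map; $I_{m+1}$ is the identity matrix of size $m+1$. $G_2$ is a generator matrix of $\{(\mathrm{Tr}_{q^m/q}(bx)+c)_{x\in D}:b\in\mathbb{F}_{q^m},c\in\mathbb{F}_q\}$. *)

(* Defs.v *)
From HB Require Import structures.
From mathcomp Require Import all_boot all_order all_algebra all_field.
Set Implicit Arguments.
Unset Strict Implicit.
Unset Printing Implicit Defensive.
Import GRing.Theory.
Local Open Scope ring_scope.

(* Absolute trace Tr_{L/F} for a finite field F and an extension L of
   degree m:  Tr(x) = x + x^q + ... + x^(q^(m-1)),  q = #|F|.
   The sum lies in F (embedded in L as F*1); [Tr] returns the element of F,
   i.e. the unique a : F with a%:A = \sum_i x^(q^i) (coordinate of the sum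
   on the basis [1] of the F-line spanned by 1). *)
Definition trsum (F : finFieldType) (L : fieldExtType F) (m : nat) (x : L) : L :=
  \sum_(i < m) x ^+ (#|F| ^ i).

Definition Tr (F : finFieldType) (L : fieldExtType F) (m : nat) (x : L) : F :=
  coord [tuple (1 : L)] ord0 (trsum m x).

Section Codes.
Variables (F : finFieldType) (N : nat).

Definition wt (c : 'rV[F]_N) : nat := #|[set i : 'I_N | c 0 i != 0]|.

Definition code k (G : 'M[F]_(k, N)) : {set 'rV[F]_N} :=
  [set c : 'rV[F]_N | (c <= G)%MS].

Definition dual_code (C : {set 'rV[F]_N}) : {set 'rV[F]_N} :=
  [set y : 'rV[F]_N | [forall c in C, c *m y^T == 0]].

Definition code_dim (C : {set 'rV[F]_N}) (k : nat) : Prop :=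
  exists B : 'M[F]_(k, N), row_free B /\ code B = C.

Definition min_dist (C : {set 'rV[F]_N}) (d : nat) : Prop :=
  (exists2 c, c \in C & c != 0 /\ wt c = d) /\
  (forall c, c \in C -> c != 0 -> (d <= wt c)%N).

End Codes.

Definition G2 (F : finFieldType) (L : fieldExtType F) (m n : nat)
  (alpha : L) (d : 'I_n -> L) : 'M[F]_(m.+1, n) :=
  \matrix_(k < m.+1, j < n)
    if k == 0%N :> nat then 1
    else Tr m (alpha ^+ k.-1 * d j) + (if k == 2%N :> nat then 1 else 0).

Definition G2' (F : finFieldType) (L : fieldExtType F) (m n : nat)
  (alpha : L) (d : 'I_n -> L) : 'M[F]_(m.+1, m.+1 + n) :=
  row_mx 1%:M (G2 m alpha d).

(* Main.v *)
Require Import Defs.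
From HB Require Import structures.
From mathcomp Require Import all_boot all_order all_algebra all_field.
From mathcomp Require Import zify ring.
Import Order.TTheory GRing.Theory Num.Theory.
Local Open Scope ring_scope.
Set Implicit Arguments.
Unset Strict Implicit.
Unset Printing Implicit Defensive.

(** A message u is encoded as u followed by (Tr (b d_j) + c)_j, where b and c
    depend linearly on u and b = c = 0 only if u = 0; so the minimum distance
    reduces to bounding N(b, c) = #{x in D | Tr (b x) = c}, b <> 0.
    - #|D| = q^(m-1): as m is odd, a nonsquare g of F stays a nonsquare in L, so
      x^2 and g x^2 together take every value exactly twice.
    - By homogeneity N(b, c) is the same for all c <> 0, so N(b, 0) determines
      everything.  If Tr (b^2) = 0, translating by F b gives N(b, 1) = q^(m-2).
      Otherwise Tr (u v) is nondegenerate on the hyperplane Tr (b x) = 0, and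
      the pairs (x, y) in it with Tr (x^2) = Tr (y^2) are counted by
      (u, v) = (x - y, x + y); this second moment and Cauchy-Schwarz give
      |N(b, 0) - q^(m-2)| <= (q - 1) q^((m-3)/2), with no exponential sums.
    For the dual, every coordinate is used by some codeword, whence d >= 2, and
    the column of G2 at d_j = 0 is e_0 + e_2, whence d <= 3. *)

(** * Cauchy-Schwarz and the second moment, over the integers *)

(** The nonnegative sum of the squares of [n * A c - S] equals [n * (n * W - S ^+ 2)], and a
    positive [n] can be cancelled. *)
Lemma sqr_sum_le (I : finType) (P : pred I) (A : I -> int) :
  (\sum_(c | P c) A c) ^+ 2 <= #|P|%:Z * \sum_(c | P c) A c ^+ 2.
Proof.
set S : int := \sum_(c | P c) A c; set W : int := \sum_(c | P c) A c ^+ 2.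
set n : int := #|P|%:Z.
have : 0 <= \sum_(c | P c) (n * A c - S) ^+ 2 by apply: sumr_ge0 => c _; apply: sqr_ge0.
have -> : \sum_(c | P c) (n * A c - S) ^+ 2 = n * (n * W - S ^+ 2).
  transitivity (\sum_(c | P c) (n ^+ 2 * A c ^+ 2 - 2 * n * S * A c + S ^+ 2)).
    by apply: eq_bigr => c _; ring.
  rewrite big_split sumrB -!mulr_sumr -/S -/W /= sumr_const -[S *+ _]mulr_natl.
  by rewrite natz -/n; ring.
have [P0|P0] := posnP #|P|.
  have -> : S = 0 by rewrite /S big_pred0 // => c; exact: (card0_eq P0).
  by move=> _; rewrite /n P0 mul0r expr0n.
by rewrite pmulr_rge0 ?subr_ge0 // /n ltz_nat.
Qed.

(* Here a is the size of one of q classes, s and w are the sums of the sizes of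
   the others and of their squares, and the last hypothesis is Cauchy-Schwarz. *)
Lemma second_moment_bound (q K a s w : nat) : (0 < q)%N -> (0 < K)%N ->
  (a + s = q ^ 2 * K ^ 2)%N ->
  (a ^ 2 + w = q ^ 2 * K ^ 2 + (q ^ 2 * K ^ 2 - 1) * (q * K ^ 2))%N ->
  (s ^ 2 <= q.-1 * w)%N ->
  ((a <= q * K ^ 2 + q.-1 * K) && (q * K ^ 2 <= a + q.-1 * K))%N.
Proof.
case: q => // r _ K0 Ea Ew CS /=.
have P1 : (0 < r.+1 ^ 2 * K ^ 2)%N by rewrite muln_gt0 !expn_gt0 K0.
have {}Ew : (a ^ 2 + w + r.+1 * K ^ 2 =
    r.+1 ^ 2 * K ^ 2 + (r.+1 ^ 2 * K ^ 2) * (r.+1 * K ^ 2))%N.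
  rewrite Ew -addnA; congr addn; rewrite -{2}(subnK P1); ring.
have /= {}CS : (s%:Z ^+ 2 <= r%:Z * w%:Z)%R by lia.
have {}Ea : (s%:Z = (r%:Z + 1) ^+ 2 * K%:Z ^+ 2 - a%:Z)%R by lia.
have {}Ew : (w%:Z = (r%:Z + 1) ^+ 2 * K%:Z ^+ 2 +
    ((r%:Z + 1) ^+ 2 * K%:Z ^+ 2 - 1) * ((r%:Z + 1) * K%:Z ^+ 2) - a%:Z ^+ 2)%R by lia.
have : ((a%:Z - (r%:Z + 1) * K%:Z ^+ 2) ^+ 2 <= (r%:Z * K%:Z) ^+ 2)%R.
  rewrite -(@ler_pM2l _ (r%:Z + 1)%R) //; last lia.
  (* Completing the square in [a]: after eliminating [s] and [w], [r + 1] times the gap between the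
     two sides is [r * w - s ^ 2]. *)
  rewrite -subr_ge0 (_ : _ - _ = r%:Z * w%:Z - s%:Z ^+ 2)%R; first by rewrite subr_ge0.
  by rewrite Ea Ew; ring.
have Y0 : (0 <= r%:Z * K%:Z)%R by lia.
rewrite -[X in (X <= _)%R]real_normK ?num_real // ler_sqr ?nnegrE //.
rewrite ler_norml => /andP[lo hi].
by apply/andP; split; lia.
Qed.

Lemma card_sum_fibers (A B : finType) (P : pred A) (f : A -> B) :
  #|[set x | P x]| = (\sum_c #|[set x | P x && (f x == c)]|)%N.
Proof.
rewrite -sum1_card (partition_big f predT) //=; apply: eq_bigr => c _.
by rewrite -sum1_card; apply: eq_bigl => x; rewrite !inE.
Qed.

(** * Fibres of linear forms and hyperplane slices of a quadric *)

Section Counting.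
Variables (F E : finFieldType) (i : {rmorphism F -> E}) (T : {additive E -> F}).
Hypothesis TZ : forall s x, T (i s * x) = s * T x.
Hypothesis Tnz : exists x, T x != 0.
Local Notation q := #|F|.

Definition form_fiber (b : E) (c : F) := [set x | T (b * x) == c].

Definition orthogonal2 (u b : E) := [set v | (T (b * v) == 0) && (T (u * v) == 0)].

(** A vector [y] with [T (b * y) = c' - c] translates one fibre onto another, so all [q] fibres have
    the same size. *)
Lemma card_form_fiber b c : b != 0 -> (q * #|form_fiber b c|)%N = #|E|.
Proof.
move=> b0; rewrite -[RHS]cardsT (card_sum_fibers xpredT (fun x => T (b * x))) /=.
rewrite -sum_nat_const; apply: eq_bigr => c' _.
have [x1 T1] := Tnz; pose y := i ((c' - c) / T x1) * x1 / b.
have Ty : T (b * y) = c' - c by rewrite /y mulrC divfK // TZ divfK.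
rewrite -(card_imset _ (@addrI _ y)); apply: eq_card => x; rewrite inE.
apply/imsetP/eqP => [[z]|Tx].
  by rewrite inE => /eqP Tz ->; rewrite mulrDr raddfD /= Ty Tz subrK.
exists (x - y); last by rewrite addrC subrK.
by rewrite inE mulrBr raddfB /= Ty Tx opprB addrC subrK.
Qed.

(* Double counting of the kernels of the forms v |-> T ((u + s b) v): a v with
   T (b v) <> 0 lies in exactly one of them, the others in all or none. *)
Lemma card_form_fiber2 (u b : E) : b != 0 -> (forall s, u + i s * b != 0) ->
  (q * (q * #|orthogonal2 u b|))%N = #|E|.
Proof.
move=> b0 ub.
have EZ := card_form_fiber 0 b0.
set Z := #|_| in EZ; set M := #|_|.
(* All [q] kernels have size [Z] and [#|E| = q * Z], so this double count of [q * Z] leaves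
   [q * M = Z]. *)
suff: (\sum_(s : F) #|form_fiber (u + i s * b)%R 0%R| = (#|E| - Z) + q * M)%N.
  have q0 : (0 < q)%N by apply/card_gt0P; exists 0.
  have -> : (\sum_(s : F) #|form_fiber (u + i s * b)%R 0%R| = \sum_(s : F) Z)%N.
    apply: eq_bigr => s _; apply/eqP; rewrite -(eqn_pmul2l q0) EZ.
    by rewrite (card_form_fiber 0 (ub s)).
  have leZ : (Z <= q * Z)%N by rewrite leq_pmull.
  rewrite sum_nat_const -EZ => h; congr muln; apply/eqP.
  by rewrite -(eqn_add2l (q * Z - Z)) -h subnK.
under eq_bigr do rewrite -sum1_card.
under eq_bigr do (under eq_bigl do rewrite inE mulrDl raddfD /= -mulrA TZ).
rewrite (exchange_big_dep predT) //= (bigID (fun v => T (b * v) != 0)) /=.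
congr addn.
  rewrite -(cardsC (form_fiber b 0)) addKn -sum1_card.
  apply: eq_big => [v|v Tb]; first by rewrite !inE.
  rewrite -[RHS](card1 (- T (u * v) / T (b * v))) -sum1_card; apply: eq_bigl => s.
  by rewrite inE addrC addr_eq0 -[LHS](inj_eq (mulIf (invr_neq0 Tb))) mulfK.
rewrite mulnC -sum_nat_const (bigID (fun v => T (u * v) == 0)) /=.
rewrite [X in (_ + X)%N]big1 ?addn0 => [|v /andP[/negPn/eqP Tb Tu]]; last first.
  by rewrite big_pred0 // => s; rewrite Tb mulr0 addr0 (negPf Tu).
apply: eq_big => [v|v /andP[/negPn/eqP Tb /eqP Tu]]; first by rewrite inE negbK.
by rewrite -sum1_card; apply: eq_bigl => s; rewrite Tb Tu mulr0 addr0 eqxx.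
Qed.

Definition quadric_slice (b : E) (c : F) := [set x | (T (x ^+ 2) == 0) && (T (b * x) == c)].

Lemma card_quadric_slice_scale b c : c != 0 ->
  #|quadric_slice b c| = #|quadric_slice b 1|.
Proof.
move=> c0; have ic0 : i c != 0 by rewrite fmorph_eq0.
rewrite -[RHS](card_imset _ (mulfI ic0)); apply: eq_card => x.
apply/idP/imsetP => [|[z + ->]]; rewrite inE => /andP[/eqP Qx /eqP Tx].
  exists (i c^-1 * x); last by rewrite mulrA -rmorphM divff // rmorph1 mul1r.
  by rewrite inE exprMn -rmorphXn TZ Qx mulr0 eqxx mulrCA TZ Tx mulVf /=.
by rewrite inE exprMn -rmorphXn TZ Qx mulr0 eqxx mulrCA TZ Tx mulr1 /=.
Qed.

Lemma card_quadric_slices b : #|[set x | T (x ^+ 2) == 0]| =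
  (#|quadric_slice b 0%R| + q.-1 * #|quadric_slice b 1%R|)%N.
Proof.
rewrite (card_sum_fibers (fun x => T (x ^+ 2) == 0) (fun x => T (b * x))).
rewrite (bigD1 0) //=; congr addn; rewrite -(cardC1 (0 : F)) -sum_nat_const.
by apply: eq_big => // c c0; exact: card_quadric_slice_scale.
Qed.

Hypothesis two : (2 : F) != 0.

(* When b is isotropic, the translations by multiples of b preserve T (b x) = 1
   and move T (x^2) bijectively along F. *)
Lemma card_quadric_slice_isotropic (b : E) : b != 0 -> T (b ^+ 2) = 0 ->
  (q * (q * #|quadric_slice b 1%R|))%N = #|E|.
Proof.
move=> b0 Qb; rewrite -(card_form_fiber 1 b0); congr muln.
pose P s := [set x | (T ((x + i s * b) ^+ 2) == 0) && (T (b * x) == 1)].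
have Qs s x : T ((x + i s * b) ^+ 2) = T (x ^+ 2) + 2 * s * T (b * x).
  rewrite (_ : _ ^+ 2 = x ^+ 2 + i (2 * s) * (b * x) + i (s ^+ 2) * b ^+ 2).
    by rewrite !raddfD /= !TZ Qb; ring.
  by rewrite rmorphM rmorphXn rmorph_nat; ring.
have -> : (q * #|quadric_slice b 1%R|)%N = (\sum_s #|P s|)%N.
  rewrite -sum_nat_const; apply: eq_bigr => s _.
  rewrite -(card_imset [in P s] (@addIr _ (i s * b))); apply: eq_card => x.
  have Tsb : T (b * (i s * b)) = 0 by rewrite mulrCA TZ -expr2 Qb mulr0.
  apply/idP/imsetP => [|[z + ->]]; rewrite inE => /andP[/eqP Qx /eqP Tx].
    exists (x - i s * b); last by rewrite subrK.
    by rewrite inE subrK Qx mulrBr raddfB /= Tx Tsb subr0 !eqxx.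
  by rewrite inE Qx mulrDr raddfD /= Tx Tsb addr0 !eqxx.
under eq_bigr do rewrite -sum1_card.
under eq_bigr do (under eq_bigl do rewrite inE).
rewrite (exchange_big_dep [in form_fiber b 1]) /=; last first.
  by move=> s x _ /andP[_]; rewrite inE.
rewrite -sum1_card; apply: eq_bigr => x; rewrite inE => /eqP Tx.
(* As [T (b * x) = 1], the condition reads [T (x ^+ 2) + 2 * s = 0] and has one solution [s]. *)
rewrite -[RHS](card1 (- T (x ^+ 2) / 2)) -sum1_card; apply: eq_bigl => s.
rewrite inE Qs Tx mulr1 eqxx andbT addrC addr_eq0.
by rewrite -[LHS](inj_eq (mulIf (invr_neq0 two))) mulrC mulKf.
Qed.

(** * Moments of the quadratic form on an anisotropic hyperplane *)

Section Anisotropic.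
Variable b : E.
Hypothesis Qb : T (b ^+ 2) != 0.

Let b0 : b != 0.
Proof. by apply: contraNneq Qb => ->; rewrite expr0n raddf0. Qed.

Let A c := #|[set x | (T (b * x) == 0) && (T (x ^+ 2) == c)]|.

Lemma sum_level : (q * \sum_c A c)%N = #|E|.
Proof.
rewrite -(card_form_fiber 0 b0); congr muln.
by rewrite (card_sum_fibers _ (fun x => T (x ^+ 2))).
Qed.

(** The sum counts pairs in the hyperplane with [T (u * v) = 0]: [u = 0] contributes the whole
    hyperplane, and each of the other [#|E| / q - 1] values of [u] contributes [#|E| / q ^ 2]. *)
Lemma sum_sqr_level :
  (q ^ 3 * \sum_c A c ^ 2 = q ^ 2 * #|E| + (#|E| - q) * #|E|)%N.
Proof.
pose H : {set E} := form_fiber b 0.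
have EH : (q * #|H|)%N = #|E| by exact: card_form_fiber.
have Tsq x y : T (x ^+ 2) - T (y ^+ 2) = T ((x - y) * (x + y)).
  by rewrite -raddfB /=; congr (T _); ring.
have two' : (2 : E) != 0 by rewrite -(rmorph_nat i) fmorph_eq0.
have -> : (\sum_c A c ^ 2)%N = #|[set z : E * E | [&& z.1 \in H, z.2 \in H & T (z.1 * z.2) == 0]]|.
  transitivity #|[set z : E * E | [&& z.1 \in H, z.2 \in H & T (z.1 ^+ 2) == T (z.2 ^+ 2)]]|.
    rewrite (card_sum_fibers _ (fun z : E * E => T (z.1 ^+ 2))).
    apply: eq_bigr => c _; rewrite -mulnn -cardsX; apply: eq_card => -[x y].
    rewrite !inE /=; case: (T (b * x) == 0) => //=; rewrite andbC -andbA.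
    case: (T (b * y) == 0) => //=; rewrite ?andbF //=.
    by apply/andP/andP => [] [/eqP-> /eqP->].
  pose f (z : E * E) := (z.1 - z.2, z.1 + z.2).
  have fI : injective f.
    move=> [x y] [z t] [/= e1 e2].
    have ex : x = z.
      apply: (mulfI two'); transitivity ((x - y) + (x + y)); first by ring.
      by rewrite e1 e2; ring.
    by move: e2; rewrite ex => /addrI ->.
  rewrite -(card_imset _ fI); apply: eq_card => -[x y].
  apply/imsetP/idP => [[[z t] + [-> ->]]|]; rewrite !inE /=.
    case/and3P=> /eqP Hz /eqP Ht /eqP Qzt.
    by rewrite mulrBr mulrDr raddfB raddfD /= Hz Ht subr0 addr0 -Tsq Qzt subrr !eqxx.
  case/and3P=> /eqP Hx /eqP Hy /eqP Txy; exists ((x + y) / 2, (y - x) / 2).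
    have half z : T (z / 2) = T z / 2.
      by rewrite -(rmorph_nat i) -fmorphV mulrC TZ mulrC.
    rewrite !inE /= !mulrA !half mulrDr mulrBr raddfB raddfD /= Hx Hy subr0 addr0.
    rewrite mul0r eqxx /= -subr_eq0 Tsq.
    rewrite (_ : _ * _ = x * y) ?Txy //.
    by field.
  by congr pair => /=; field.
rewrite (card_sum_fibers _ (fun z : E * E => z.1)).
have -> : (\sum_c #|[set x : E * E | [&& x.1 \in H, x.2 \in H & T (x.1 * x.2)%R == 0%R] && (x.1 == c)]|
   = \sum_(u in H) #|orthogonal2 u b|)%N.
  rewrite [RHS]big_mkcond; apply: eq_bigr => u _; case: ifPn => uH; last first.
    apply/eqP; rewrite cards_eq0; apply/eqP/setP=> -[x y]; rewrite !inE /=.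
    apply/negbTE; apply: contra uH => /andP[/and3P[Tx _ _] /eqP <-].
    by rewrite inE.
  have pI : injective (fun v : E => (u, v)) by move=> ? ? [].
  rewrite -[RHS](card_imset _ pI); apply: eq_card => -[x y].
  apply/idP/imsetP => [|[v + [-> ->]]]; rewrite !inE /=.
    by case/andP=> /and3P[_ yb xy] /eqP <-; exists y; rewrite ?inE ?yb.
  by move=> /andP[-> ->]; move: uH; rewrite inE => ->; rewrite eqxx.
have H0 : 0 \in H by rewrite inE mulr0 raddf0.
rewrite (bigD1 0) //=.
have -> : #|orthogonal2 0 b| = #|H|.
  by apply: eq_card => v; rewrite !inE mul0r raddf0 eqxx andbT.
rewrite mulnDr; congr addn; first by rewrite -EH; ring.
rewrite (_ : q ^ 3 = q * (q * q))%N; last by ring.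
rewrite -!mulnA 2!big_distrr /=.
rewrite (eq_bigr (fun=> #|E|)) => [|u /andP[uH u0]].
  rewrite (eq_bigl [in H :\ 0]) => [|u]; last by rewrite !inE andbC.
  rewrite sum_nat_const; move: (cardsD1 0 H); rewrite H0 -{2}EH => ->.
  by rewrite mulnDr muln1 addKn mulnA.
(* If [u = - s b], then pairing with [b] gives [s * T (b ^+ 2) = 0]; anisotropy forces [s = 0],
   hence [u = 0]. *)
apply: card_form_fiber2 => // s; apply: contraTneq uH => us.
rewrite inE; apply: contraNneq u0 => Tu.
have : s * T (b ^+ 2) = 0.
  by rewrite -TZ expr2 mulrA -[i s * b](addKr u) us addr0 mulNr raddfN /= mulrC Tu oppr0.
move/eqP; rewrite mulf_eq0 (negPf Qb) orbF => /eqP s0.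
by move: us; rewrite s0 rmorph0 mul0r addr0 => ->.
Qed.

(** The mean size of a level is [q * K ^ 2]; Cauchy-Schwarz over the nonzero levels bounds the
    deviation of level 0. [K] will be q^((m-3)/2). *)
Lemma level0_deviation (K : nat) : #|E| = (q ^ 3 * K ^ 2)%N ->
  (A 0%R <= q * K ^ 2 + q.-1 * K)%N && (q * K ^ 2 <= A 0%R + q.-1 * K)%N.
Proof.
move=> EK.
have q0 : (0 < q)%N by apply/card_gt0P; exists 0.
have K0 : (0 < K)%N.
  have : (0 < #|E|)%N by apply/card_gt0P; exists 0.
  by rewrite EK muln_gt0 !expn_gt0 !orbF => /andP[].
have S1 : (\sum_c A c = q ^ 2 * K ^ 2)%N.
  by apply/eqP; rewrite -(eqn_pmul2l q0) sum_level EK; apply/eqP; ring.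
have S2 : (\sum_c A c ^ 2 = q ^ 2 * K ^ 2 + (q ^ 2 * K ^ 2 - 1) * (q * K ^ 2))%N.
  apply/eqP; rewrite -(@eqn_pmul2l (q ^ 3)) ?expn_gt0 ?q0 // sum_sqr_level EK.
  have -> : (q ^ 3 * K ^ 2 - q = q * (q ^ 2 * K ^ 2 - 1))%N.
    by rewrite mulnBr muln1 mulnA -expnS.
  by apply/eqP; ring.
have CS : ((\sum_(c | c != 0%R) A c) ^ 2 <= q.-1 * \sum_(c | c != 0%R) A c ^ 2)%N.
  have := sqr_sum_le [pred c : F | c != 0] (fun c => (A c)%:R).
  rewrite cardC1 -natr_sum -natz.
  under [X in _ * X]eq_bigr do rewrite -natrX.
  by rewrite -natr_sum -natrX -natrM ler_nat.
rewrite (bigD1 (0 : F)) //= in S1; rewrite (bigD1 (0 : F)) //= in S2.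
exact: second_moment_bound q0 K0 S1 S2 CS.
Qed.

End Anisotropic.

(** For isotropic [b] every slice has exactly [q * K ^ 2] points. Otherwise the upper deviation
    bound handles [c = 0], and the lower one handles the equal slices at [c != 0] through the
    total. *)
Lemma card_quadric_slice_le b c (K : nat) : b != 0 ->
  #|E| = (q ^ 3 * K ^ 2)%N -> #|[set x | T (x ^+ 2) == 0]| = (q ^ 2 * K ^ 2)%N ->
  (#|quadric_slice b c| <= q * K ^ 2 + q.-1 * K)%N.
Proof.
move=> b0 EK DK.
have q1 : (1 < q)%N by exact: finNzRing_gt1.
rewrite (card_quadric_slices b) in DK.
have slice1 : c != 0 -> #|quadric_slice b c| = #|quadric_slice b 1|.
  exact: card_quadric_slice_scale.
have [Qb|Qb] := eqVneq (T (b ^+ 2)) 0.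
  have := card_quadric_slice_isotropic b0 Qb; rewrite EK => E1.
  have {}E1 : #|quadric_slice b 1| = (q * K ^ 2)%N.
    apply/eqP; rewrite -(@eqn_pmul2l (q * q)) ?muln_gt0 ?(ltnW q1) //.
    by rewrite -mulnA E1; apply/eqP; ring.
  have [->|c0] := eqVneq c 0; last by rewrite slice1 // E1 leq_addr.
  have -> : #|quadric_slice b 0| = (q * K ^ 2)%N; last by rewrite leq_addr.
  apply/eqP; rewrite -(eqn_add2r (q.-1 * (q * K ^ 2))) -{1}E1 DK -mulSn prednK.
    by apply/eqP; ring.
  exact: ltnW.
have /andP[hi lo] := level0_deviation Qb EK.
have E0 : #|[set x | (T (b * x) == 0) && (T (x ^+ 2) == 0)]| = #|quadric_slice b 0|.
  by apply: eq_card => x; rewrite !inE andbC.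
rewrite E0 in hi lo.
have [->//|c0] := eqVneq c 0; rewrite slice1 //.
move: q1 DK hi lo; move: #|quadric_slice b 0| #|quadric_slice b 1| q => N0 N1 [//|r] /=.
move=> r0 DK hi lo; rewrite -(@leq_pmul2l r) //.
(* A deficit of at most [r * K] in [N0] is shared by [r] slices of size [N1], so each gains at most
   [K]. *)
have : (r * N1 <= r * (r.+1 * K ^ 2 + K))%N by lia.
rewrite !leq_pmul2l // => /leq_trans; apply; rewrite leq_add2l leq_pmull //.
Qed.

(* x ^+ 2 and i g * x ^+ 2 together cover every y twice, and they have the same
   number of zeros of T since T (i g * z) = g * T z. *)
Lemma card_quadric g :
  (forall x, x ^+ 2 != i g) ->
  (forall y, exists x, y = x ^+ 2 \/ y = i g * x ^+ 2) ->
  #|[set x | T (x ^+ 2) == 0]| = #|[set y | T y == 0]|.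
Proof.
move=> gN gC.
have ig0 : i g != 0 by rewrite eq_sym; have := gN 0; rewrite expr0n.
have g0 : g != 0 by rewrite -(fmorph_eq0 i).
have two' : (2 : E) != 0 by rewrite -(rmorph_nat i) fmorph_eq0.
have roots2 (a : E) : a != 0 -> #|[set x | x ^+ 2 == a ^+ 2]| = 2%N.
  move=> a0; rewrite (_ : [set x | _] = [set a; - a]).
    by rewrite cards2 -subr_eq0 opprK -mulr2n -[a *+ 2]mulr_natl mulf_eq0 (negPf two') (negPf a0).
  by apply/setP => x; rewrite !inE eqf_sqr.
have sq0 : #|[set x : E | x ^+ 2 == 0]| = 1%N.
  rewrite (_ : [set x | _] = [set 0]) ?cards1 //.
  by apply/setP => x; rewrite !inE expf_eq0.
(* At [y = 0] each map has the single root 0; elsewhere one map has two roots and the other none,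
   because [i g] is a nonsquare. *)
have fiber2 y : (#|[set x | (x ^+ 2 == y)%R]| + #|[set x | (i g * x ^+ 2 == y)%R]|)%N = 2%N.
  have gsq x z : (i g * x ^+ 2 == i g * z) = (x ^+ 2 == z).
    exact: (inj_eq (mulfI ig0)).
  have [x xy] := gC y; have [x0|x0] := eqVneq x 0.
    have -> : y = 0 by case: xy => ->; rewrite x0 expr0n ?mulr0.
    rewrite sq0 (eq_card (B := [set x : E | x ^+ 2 == 0])) ?sq0 // => z.
    by rewrite !inE mulf_eq0 (negPf ig0).
  case: xy => ->.
    rewrite roots2 // (_ : [set z | _] = set0) ?cards0 //; apply/setP => z.
    rewrite !inE; apply/negbTE; have [->|z0] := eqVneq z 0.
      by rewrite expr0n mulr0 eq_sym expf_eq0.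
    apply: contra (gN (x / z)) => /eqP zx.
    by rewrite expr_div_n -zx mulfK // expf_neq0.
  rewrite [X in (X + _)%N](_ : _ = 0%N).
    rewrite add0n -[RHS](roots2 x x0); apply: eq_card => z; rewrite !inE; exact: gsq.
  apply: eq_card0 => z; rewrite inE; apply/negbTE; apply: contra (gN (z / x)) => /eqP zx.
  by rewrite expr_div_n zx mulfK // expf_neq0.
have := card_sum_fibers (fun x => T (x ^+ 2) == 0) (fun x => x ^+ 2).
have := card_sum_fibers (fun x => T (i g * x ^+ 2) == 0) (fun x => i g * x ^+ 2).
rewrite (eq_card (B := [set x | T (x ^+ 2) == 0])) => [D2 D1|x]; last first.
  by rewrite !inE TZ mulf_eq0 (negPf g0).
apply/eqP; rewrite -(@eqn_pmul2r 2) // muln2 -addnn {1}D1 D2 -big_split /=; apply/eqP.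
rewrite -sum_nat_const [RHS]big_mkcond; apply: eq_bigr => y _; rewrite inE.
case: ifPn => Ty; last first.
  by rewrite !eq_card0 // => x; rewrite inE; apply/negbTE/negP;
     case/andP=> Tx /eqP xy; move: Ty; rewrite -xy Tx.
rewrite -[RHS](fiber2 y); congr addn; apply: eq_card => x; rewrite !inE;
  by apply/andP/idP => [[]|xy] //; split => //; rewrite (eqP xy).
Qed.

End Counting.

(** * Nonsquares and the Frobenius map *)

(** Otherwise squaring would be onto, hence injective on a finite set, although 1 and -1 have the
    same square. *)
Lemma exists_nonsquare (F : finFieldType) : (2 : F) != 0 ->
  exists g : F, forall x, x ^+ 2 != g.
Proof.
move=> two.
have [g /forallP gN|sq] := pickP (fun g : F => [forall x, x ^+ 2 != g]); first by exists g.
have /imset_injP inj : #|(fun x : F => x ^+ 2) @: F| == #|F|.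
  rewrite -cardsT; apply/eqP/eq_card => y; rewrite inE; apply/imsetP.
  by have /negbT := sq y; rewrite negb_forall => /existsP[x /negPn/eqP<-]; exists x.
have := inj 1 (- 1) isT isT; rewrite sqrrN => /(_ erefl)/eqP.
by rewrite -subr_eq0 opprK => two0; case/negP: two.
Qed.

Section Frobenius.
Variables (F : finFieldType).

Lemma expf_card_iter (a : F) k : a ^+ (#|F| ^ k) = a.
Proof. by elim: k => [|k IHk]; rewrite ?expr1 // expnSr exprM IHk expf_card. Qed.

Lemma pchar_nat_card (R : nzRingType) (f : {rmorphism F -> R}) k : [pchar R].-nat (#|F| ^ k)%N.
Proof.
have [p p_pr pF] := finPcharP F.
have pR : p \in [pchar R] by exact: (rmorph_pchar f pF).
rewrite pnatX; apply/orP; left.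
have := card_pprimeChar pF => ->.
by rewrite pnatX (eq_pnat _ (pcharf_eq pR)) pnat_id.
Qed.

(** [x] is a root of X^q - X, which splits over [F] as the product of all X - a. *)
Lemma frobenius_fixed (E : fieldType) (i : {rmorphism F -> E}) (x : E) :
  x ^+ #|F| = x -> exists a, x = i a.
Proof.
move=> xq; have /(congr1 (fun p : {poly F} => (map_poly i p).[x])) := finField_genPoly F.
rewrite rmorphB /= map_polyXn map_polyX !hornerE xq subrr rmorph_prod /= horner_prod.
move/esym/eqP/prodf_eq0 => [a _]; rewrite rmorphB /= map_polyX map_polyC !hornerE.
by rewrite subr_eq0 => /eqP ->; exists a.
Qed.

(** A square root [x] of [i g] is sent to [x] or [- x] by Frobenius. The first puts [x] in [F]; in
    the second, the [m]-th iterate, which is the identity, negates [x] as [m] is odd, so [x = 0] and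
    [g = 0] is a square. *)
Lemma nonsquare_odd_ext (E : finFieldType) (i : {rmorphism F -> E}) m g :
  (2 : F) != 0 -> odd m -> #|E| = (#|F| ^ m)%N ->
  (forall x : F, x ^+ 2 != g) -> forall x : E, x ^+ 2 != i g.
Proof.
move=> two m_odd cardE gN x; apply/eqP => xg.
have /eqP : (x ^+ #|F|) ^+ 2 = x ^+ 2.
  by rewrite exprAC xg -rmorphXn expf_card.
rewrite eqf_sqr => /orP[/eqP/(frobenius_fixed i)[a xa]|/eqP xN].
  move/eqP: xg; rewrite xa -rmorphXn fmorph_eq; exact/negP/gN.
have xk k : x ^+ (#|F| ^ k) = i ((-1) ^+ k) * x.
  elim: k => [|k IHk]; first by rewrite rmorph1 mul1r.
  rewrite expnSr exprM IHk exprMn -rmorphXn expf_card xN exprS mulN1r.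
  by rewrite rmorphN mulrN mulNr.
have := expf_card x; rewrite cardE xk -signr_odd m_odd rmorphN1 mulN1r => /eqP.
rewrite eq_sym -subr_eq0 opprK -mulr2n -mulr_natl mulf_eq0 -(rmorph_nat i).
rewrite fmorph_eq0 (negPf two) /= => /eqP x0.
have := gN 0; rewrite -(fmorph_eq i) -xg x0 expr0n /= expr0n /= rmorph0; case/negP.
exact: eqxx.
Qed.

End Frobenius.

(** * The trace: linearity, values in [F], nonvanishing *)

Section Trace.
Variables (F : finFieldType) (L : fieldExtType F) (m : nat).
Local Notation q := #|F|.

Lemma trsum_linear a (x y : L) : trsum m (a *: x + y) = a *: trsum m x + trsum m y.
Proof.
rewrite /trsum scaler_sumr -big_split; apply: eq_bigr => i _ /=.
rewrite exprDn_pchar ?(pchar_nat_card (in_alg L)) //.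
by rewrite exprZn expf_card_iter.
Qed.

Lemma Tr_linear a (x y : L) : Tr m (a *: x + y) = a * Tr m x + Tr m y.
Proof. by rewrite /Tr trsum_linear linearP. Qed.

HB.instance Definition _ := GRing.isLinear.Build F L F *%R (@Tr F L m) Tr_linear.

Lemma TrZ a (x : L) : Tr m (a *: x) = a * Tr m x.
Proof. by rewrite linearZ. Qed.

Hypothesis dimL : \dim {:L} = m.

Lemma card_finvect : #|finvect_type L| = (q ^ m)%N.
Proof. by rewrite -(card_vspacef (Vector.class (finvect_type L))) card_vspace dimL. Qed.

(** Frobenius permutes the summands cyclically since x^(q^m) = x, so the sum lies in [F] and its
    coordinate on 1 recovers it. *)
Lemma TrE (x : L) : (Tr m x)%:A = trsum m x.
Proof.
have xq : x ^+ (q ^ m) = x by rewrite -card_finvect; exact: (@expf_card (finvect_type L)).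
have : trsum m x ^+ q = trsum m x.
  have -> : trsum m x ^+ q = \sum_(i < m) (x ^+ (q ^ i)) ^+ q.
    rewrite /trsum; elim/big_rec2: _ => [|j y z _ <-].
      by rewrite expr0n; have := finNzRing_gt1 F; case: #|_|.
    by rewrite exprDn_pchar // -[q]expn1 (pchar_nat_card (in_alg L)).
  rewrite /trsum; case: {+}m xq => [|k] xq; first by rewrite !big_ord0.
  rewrite big_ord_recr big_ord_recl /= -exprM -expnSr xq expr1 addrC.
  by congr (_ + _); apply: eq_bigr => j _; rewrite -exprM -expnSr.
case/(frobenius_fixed (in_alg L)) => a /= xa; rewrite /Tr xa linearZ /=.
rewrite -[X in coord _ _ X]/([tuple (1 : L)]`_(ord0 : 'I_1)) coord_free ?mulr1 //.
by rewrite seq1_free oner_neq0.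
Qed.

(** The trace polynomial has degree at most q^(m-1), too small to vanish on all q^m elements; its
    coefficient at X is 1. *)
Lemma Tr_nonzero : (0 < m)%N -> exists x : L, Tr m x != 0.
Proof.
move=> m0; pose p : {poly finvect_type L} := \sum_(i < m) 'X^(q ^ i).
have q1 := finNzRing_gt1 F.
have p0 : p != 0.
  apply/eqP => /(congr1 (fun p : {poly _} => p`_1)).
  rewrite coef0 coef_sum; case: {+}m m0 => // k _; rewrite big_ord_recl big1 /=.
    by rewrite coefXn addr0 => /eqP; rewrite oner_eq0.
  move=> j _; rewrite coefXn [_ == _](_ : _ = false) //.
  by apply/negbTE; rewrite neq_ltn -[X in (X < _)%N](expn0 q) ltn_exp2l.
have szp : (size p <= (q ^ m.-1).+1)%N.
  apply: (leq_trans (size_sum _ _ _)); apply/bigmax_leqP => j _.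
  by rewrite size_polyXn ltnS leq_exp2l // -ltnS prednK.
have [x Tx|T0] := pickP (fun x : finvect_type L => Tr m (x : L) != 0); first by exists x.
suff : (#|finvect_type L| < size p)%N.
  rewrite card_finvect => /leq_trans/(_ szp); rewrite ltnS leq_exp2l //.
  by case: {+}m m0 => // k _; rewrite ltnn.
rewrite cardE; apply: max_poly_roots => //; last exact: enum_uniq.
apply/allP => x _; rewrite /root horner_sum.
under eq_bigr do rewrite hornerXn.
by have := TrE x; rewrite /trsum => <-; move/negPn/eqP: (T0 x) => /= ->; rewrite scale0r.
Qed.

End Trace.

(** * Weights, systematic generator matrices and duals *)

Section GeneralCodes.
Variable F : finFieldType.

Lemma min_dist_exists N (C : {set 'rV[F]_N}) c0 lo :
  c0 \in C -> c0 != 0 -> (forall c, c \in C -> c != 0 -> (lo <= wt c)%N) ->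
  exists d, min_dist C d /\ (lo <= d <= wt c0)%N.
Proof.
move=> Cc0 c0n lower.
have P0 : [pred c | (c \in C) && (c != 0)] c0 by rewrite /= Cc0.
case: (arg_minnP (@wt F N) P0) => c /andP[Cc cn] cmin.
exists (wt c); split; last by rewrite lower ?cmin.
split; first by exists c.
by move=> c' Cc' cn'; apply: cmin; rewrite /= Cc'.
Qed.

Lemma wt_sum N (c : 'rV[F]_N) : wt c = (\sum_j (c 0%R j != 0%R))%N.
Proof.
by rewrite /wt -sum1_card big_mkcond; apply: eq_bigr => j _; rewrite inE; case: ifP.
Qed.

Lemma wt_row_mx k n (u : 'rV[F]_k) (v : 'rV[F]_n) : wt (row_mx u v) = (wt u + wt v)%N.
Proof.
rewrite !wt_sum big_split_ord /=.
by congr addn; apply: eq_bigr => j _; rewrite ?row_mxEl ?row_mxEr.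
Qed.

Lemma wt_gt0 N (c : 'rV[F]_N) : c != 0 -> (0 < wt c)%N.
Proof.
move=> c0; rewrite lt0n; apply: contra c0; rewrite cards_eq0 => /eqP c0.
by apply/eqP/rowP => j; apply/eqP; move/setP/(_ j): c0; rewrite !inE mxE => /negbFE.
Qed.

Lemma mem_code k N (G : 'M[F]_(k, N)) (u : 'rV[F]_k) : u *m G \in code G.
Proof. by rewrite inE submxMl. Qed.

Lemma codeP k N (G : 'M[F]_(k, N)) c :
  reflect (exists u, c = u *m G) (c \in code G).
Proof. by rewrite inE; exact: submxP. Qed.

Lemma mem_dual_code k N (G : 'M[F]_(k, N)) y :
  (y \in dual_code (code G)) = (G *m y^T == 0).
Proof.
rewrite inE; apply/forall_inP/eqP => [H|H c /codeP[u ->]].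
  apply/row_matrixP => a; rewrite row_mul row0; apply/eqP/H.
  by rewrite rowE mem_code.
by rewrite -mulmxA H mulmx0.
Qed.

Lemma row_free_row_mx1 k n (G : 'M[F]_(k, n)) : row_free (row_mx 1%:M G).
Proof.
by apply/row_freeP; exists (col_mx 1%:M 0); rewrite mul_row_col mulmx1 mulmx0 addr0.
Qed.

(** A word (y1, y2) is orthogonal to all rows exactly when y1 = - y2 G^T, so y2 is a free
    message. *)
Lemma dual_code_systematic k n (G : 'M[F]_(k, n)) :
  dual_code (code (row_mx 1%:M G)) = code (row_mx (- G^T) 1%:M).
Proof.
apply/setP => y; rewrite mem_dual_code -[y]hsubmxK tr_row_mx mul_row_col mul1mx.
apply/eqP/codeP => [H|[u]].
  exists (rsubmx y); rewrite mul_mx_row mulmx1 mulmxN; congr row_mx.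
  apply: trmx_inj; rewrite linearN /= trmx_mul trmxK.
  by apply/eqP; rewrite -addr_eq0 H.
rewrite mul_mx_row mulmx1 mulmxN => /eq_row_mx[-> ->].
by rewrite linearN /= trmx_mul trmxK addNr.
Qed.

Lemma code_dim_dual_systematic k n (G : 'M[F]_(k, n)) :
  code_dim (dual_code (code (row_mx 1%:M G))) n.
Proof.
exists (row_mx (- G^T) 1%:M); split; last by rewrite dual_code_systematic.
by apply/row_freeP; exists (col_mx 0 1%:M); rewrite mul_row_col mulmx1 mulmx0 add0r.
Qed.

(** A dual word supported at [j] alone would force every codeword to vanish at [j]. *)
Lemma dual_wt_ge2 N (C : {set 'rV[F]_N}) y :
  (forall j, exists2 c, c \in C & c 0 j != 0) ->
  y \in dual_code C -> y != 0 -> (2 <= wt y)%N.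
Proof.
move=> Cj; rewrite inE => /forall_inP Cy y0; rewrite ltnNge; apply/negP => wt1.
have := wt_gt0 y0; rewrite card_gt0 => /set0Pn[j]; rewrite inE => yj.
have yk k : k != j -> y 0 k = 0.
  move=> kj; apply/eqP; apply: contraNT kj => yk.
  by apply/eqP; apply: (card_le1_eqP wt1); rewrite ?inE.
have [c Cc cj] := Cj j; have /eqP/matrixP/(_ 0 0) := Cy c Cc.
rewrite !mxE (bigD1 j) //= big1 => [|k kj]; last by rewrite !mxE yk ?mulr0.
rewrite !mxE addr0 => /eqP; rewrite mulf_eq0 (negPf cj) /=.
by rewrite (negPf yj).
Qed.

End GeneralCodes.

(** * Powers of [alpha] and the quadric of the trace form *)

(** [alpha] generates [L] over [F], so its minimal polynomial has degree [m] and divides no nonzero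
    polynomial of smaller degree. *)
Lemma generator_powers_free (F : finFieldType) (L : fieldExtType F) (alpha : L) m
    (a : 'I_m -> F) :
  \dim {:L} = m -> (forall x : L, x != 0 -> exists k, x = alpha ^+ k) ->
  \sum_(k < m) a k *: alpha ^+ k = 0 -> forall k, a k = 0.
Proof.
move=> dimL gen a0 k.
pose p : {poly L} := \poly_(j < m) (if insub j is Some k then (a k)%:A else 0).
have pE (j : 'I_m) : p`_j = (a j)%:A by rewrite coef_poly ltn_ord valK.
have full : <<1%VS; alpha>>%VS = fullv.
  apply/vspaceP => x; rewrite memvf; have [->|x0] := eqVneq x 0; first exact: mem0v.
  by have [j ->] := gen x x0; rewrite rpredX // memv_adjoin.
have szm : size (minPoly 1%VS alpha) = m.+1.
  by rewrite size_minPoly; congr S; rewrite -dimL -full dim_Fadjoin dimv1 muln1.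
have p1 : p \is a polyOver 1%VS.
  apply/polyOverP => j; rewrite coef_poly; case: ifP => _; last exact: mem0v.
  by case: insub => [j'|]; rewrite ?mem0v // memvZ ?memv_line.
have : root p alpha.
  rewrite /root (@horner_coef_wide _ m) ?size_poly //; apply/eqP; rewrite -[RHS]a0.
  by apply: eq_bigr => j _; rewrite pE mulr_algl.
move/(minPoly_dvdp p1) => dvd_p.
have p0 : p = 0.
  apply: contraTeq dvd_p => p0; apply/negP => /(dvdp_leq p0); rewrite szm.
  by rewrite leqNgt ltnS size_poly.
by move: (pE k); rewrite p0 coef0 => /esym/eqP; rewrite scaler_eq0 oner_eq0 orbF => /eqP.
Qed.

Section Quadric.
Variables (F : finFieldType) (L : fieldExtType F) (m : nat) (alpha : L).
Hypothesis two : (2 : F) != 0.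
Hypothesis m_odd : odd m.
Hypothesis dimL : \dim {:L} = m.
Hypothesis gen : forall x : L, x != 0 -> exists k, x = alpha ^+ k.
Local Notation q := #|F|.
Local Notation E := (finvect_type L).

(** The trace read on [finvect_type L], the finite copy of [L] on which sets can be counted. *)
Definition trace_map : {additive E -> F} := (@Tr F L m : {additive L -> F}).

Let emb : {rmorphism F -> E} := in_alg E.

Let TZ (s : F) (x : E) : trace_map (emb s * x) = s * trace_map x.
Proof. by rewrite [emb s * x]mulr_algl; exact: TrZ. Qed.

Let Tnz : exists x, trace_map x != 0.
Proof. by apply: Tr_nonzero => //; exact: odd_gt0. Qed.

Lemma card_trace_quadric : #|[set x : E | Tr m ((x : L) ^+ 2) == 0]| = (q ^ m.-1)%N.
Proof.
have [g gN] := exists_nonsquare two.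
have gE := nonsquare_odd_ext emb two m_odd (card_finvect dimL) gN.
have [j gj] : exists j, emb g = alpha ^+ j.
  by apply: gen; have := gE 0; rewrite eq_sym expr0n.
(* Being a nonsquare, [g] is an odd power of [alpha]; for [y] an odd power, [y * g] is a square x^2,
   and y = g (x / g)^2. *)
have gC (y : E) : exists x : E, y = x ^+ 2 \/ y = emb g * x ^+ 2.
  have even_sq k : ~~ odd k -> exists x : E, (alpha : E) ^+ k = x ^+ 2.
    by move=> k2; exists (alpha ^+ k./2); rewrite -exprM muln2 even_halfK.
  have j_odd : odd j.
    by apply: contraT => /even_sq[x]; rewrite -[LHS]gj => /esym/eqP; rewrite (negPf (gE x)).
  have [->|y0] := eqVneq y 0; first by exists 0; left; rewrite expr0n.
  have [k ->] := gen y0; have [k_odd|/even_sq[x]] := boolP (odd k); last by exists x; left.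
  have [|x Ex] := even_sq (k + j)%N; first by rewrite oddD k_odd j_odd.
  have g0 : emb g != 0 by have := gE 0; rewrite eq_sym expr0n.
  exists (x / emb g); right; rewrite expr_div_n -Ex exprD.
  have -> : (alpha : E) ^+ j = emb g by [].
  by field.
have := card_quadric TZ two gE gC; rewrite /= => ->.
have := card_form_fiber TZ Tnz 0 (oner_neq0 E).
rewrite (card_finvect dimL) -[in RHS](prednK (odd_gt0 m_odd)) expnS => /eqP.
rewrite eqn_pmul2l => [/eqP <-|]; last by apply/card_gt0P; exists 0.
by apply: eq_card => x; rewrite !inE mul1r.
Qed.

Lemma card_trace_slice_le k (b : E) c : m = (k.*2 + 3)%N -> b != 0 ->
  (#|[set x : E | (Tr m ((x : L) ^+ 2) == 0)%R && (Tr m ((b : L) * x)%R == c)]|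
    <= q * (q ^ k) ^ 2 + q.-1 * q ^ k)%N.
Proof.
move=> mk b0; apply: (card_quadric_slice_le TZ Tnz two c b0).
  by rewrite (card_finvect dimL) mk -expnM -expnD muln2 addnC.
have := card_trace_quadric; rewrite /= => ->.
by rewrite mk -expnM -expnD muln2; congr expn; lia.
Qed.

End Quadric.

(** * Codewords of [G2] as affine trace functions *)

Section CodeG2.
Variables (F : finFieldType) (L : fieldExtType F) (m n : nat) (alpha : L) (d : 'I_n -> L).

Definition message_point (u : 'rV[F]_m.+1) : L :=
  \sum_(k < m) u 0 (lift ord0 k) *: alpha ^+ k.

(** The term at [k = 1] collects the constant 1 added in the third row of [G2]. *)
Definition message_shift (u : 'rV[F]_m.+1) : F :=
  u 0 0 + \sum_(k < m) u 0 (lift ord0 k) * (if k == 1%N :> nat then 1 else 0).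

Lemma mulmx_G2 u j :
  (u *m G2 m alpha d) 0 j = Tr m (message_point u * d j) + message_shift u.
Proof.
rewrite mxE big_ord_recl mxE /= mulr1 addrC /message_shift [in RHS]addrCA [RHS]addrC.
congr (_ + _); rewrite /message_point mulr_suml raddf_sum -big_split /=.
apply: eq_bigr => k _; rewrite mxE /= /bump /= add1n mulrDr -scalerAl TrZ eqSS.
by [].
Qed.

End CodeG2.

Unset Implicit Arguments.

(** * Parameters of the extended code and of its dual *)

Theorem theorem3p19 (p e m : nat) (F : finFieldType) (L : fieldExtType F)
  (alpha : L) (n : nat) (d : 'I_n -> L) :
  prime p -> odd p -> (0 < e)%N -> #|F| = (p ^ e)%N ->
  (3 <= m)%N -> odd m -> \dim {:L} = m ->
  (* alpha generates the multiplicative group of L *)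
  (forall x : L, x != 0 -> exists k : nat, x = alpha ^+ k) ->
  (* d_1, ..., d_n is an enumeration (without repetition) of D *)
  injective d ->
  (forall x : L, Tr m (x ^+ 2) = 0 <-> exists j, d j = x) ->
  let q := #|F| in
  let C := code (G2' m alpha d) in
  [/\ (m.+1 + n = q ^ (m - 1) + m + 1)%N,
      code_dim C m.+1,
      (exists d', min_dist C d' /\
         ((q - 1) * q ^ ((m - 3) %/ 2) * (q ^ ((m - 1) %/ 2) - 1) + 1 <= d')%N),
      code_dim (dual_code C) (q ^ (m - 1))%N &
      (exists d'', min_dist (dual_code C) d'' /\ (2 <= d'' <= 3)%N)].
Proof.
move=> p_pr p_odd e_gt0 cardF m3 m_odd dimL gen d_inj dP q C.
have two : (2 : F) != 0.
  have pF := card_finPcharP cardF p_pr.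
  by rewrite -(dvdn_pcharf pF) dvdn_prime2 //; apply: contraTneq p_odd => ->.
have q1 : (1 < q)%N by exact: finNzRing_gt1.
pose dE : 'I_n -> finvect_type L := d.
have dE_inj : injective dE by [].
have dQ j : Tr m (d j ^+ 2) = 0 by apply/dP; exists j.
have nE : n = (q ^ (m - 1))%N.
  rewrite subn1 -(card_trace_quadric two m_odd dimL gen) -[LHS]card_ord.
  rewrite -(card_imset _ dE_inj); apply: eq_card => x; rewrite inE.
  by apply/imsetP/eqP => [[j _ ->] | /dP[j <-]]; [exact: dQ | exists j].
have [j0 dj0] : exists j, d j = 0 by apply/dP; rewrite expr0n raddf0.
split.
- by rewrite -nE; lia.
- by exists (G2' m alpha d); split => //; exact: row_free_row_mx1.
- have /andP[] : ((m - 3) %/ 2 == (m - 3)./2)%N && ((m - 1) %/ 2 == (m - 3)./2.+1)%N by lia.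
  move=> /eqP -> /eqP ->; set k := (m - 3)%N./2.
  have mk : m = (k.*2 + 3)%N by rewrite /k; lia.
  have G'0 (u : 'rV[F]_m.+1) : (u *m G2' m alpha d == 0) = (u == 0).
    by rewrite -[X in _ == X](mul0mx _ (G2' m alpha d))
         (inj_eq (row_free_inj (row_free_row_mx1 _))).
  have [||c Cc cn|d' [d'min /andP[lo _]]] := @min_dist_exists F _ C (row 0 (G2' m alpha d))
    ((q - 1) * q ^ k * (q ^ k.+1 - 1) + 1)%N.
  + by rewrite rowE mem_code.
  + rewrite rowE G'0; apply/eqP => /rowP/(_ 0)/eqP; rewrite !mxE eqxx oner_eq0 //.
  + have /codeP[u cE] := Cc; move: cn; rewrite cE G'0 => u0.
    (* The systematic part [u] is nonzero and supplies the final [+ 1]. *)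
    rewrite mul_mx_row mulmx1 wt_row_mx [leqRHS]addnC; apply: leq_add; last exact: wt_gt0.
    set b := message_point alpha u; set c1 := message_shift u.
    pose Z := [set j | (u *m G2 m alpha d) 0 j == 0].
    have wtZ : (wt (u *m G2 m alpha d) + #|Z| = n)%N.
      rewrite -[RHS]card_ord -(cardsC Z) addnC; congr addn.
      by apply: eq_card => j; rewrite !inE.
    have ZN : (#|Z| <= q * (q ^ k) ^ 2 + q.-1 * q ^ k)%N.
      (* If [b = 0], only the first coordinate of [u] survives, and the [G2] part is a nonzero
         constant without zeros; otherwise its zeros embed in the slice at [- c1]. *)
      have [b0|b0] := eqVneq b 0.
        have uS := generator_powers_free dimL gen b0.
        rewrite eq_card0 // => j; rewrite inE mulmx_G2 -/b b0 mul0r raddf0 add0r.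
        rewrite /message_shift big1 ?addr0 => [|l _]; last by rewrite uS mul0r.
        apply: contraNF u0 => /eqP u00; apply/eqP/rowP => l; rewrite mxE.
        by case: (unliftP ord0 l) => [l' ->|->]; [exact: uS | exact: u00].
      apply: leq_trans (card_trace_slice_le two m_odd dimL gen (- c1) mk b0).
      rewrite -(card_imset _ dE_inj); apply: subset_leq_card.
      apply/subsetP => x /imsetP[j + ->]; rewrite !inE mulmx_G2 -/b -/c1 dQ eqxx /=.
      by rewrite addr_eq0.
    (* With [K = q ^ k]: q^2 K^2 - (q K^2 + (q-1) K) = (q-1) K (q K - 1). *)
    move: #|Z| (wt _) wtZ ZN => z w; rewrite nE mk.
    rewrite (_ : q ^ (k.*2 + 3 - 1) = q ^ 2 * (q ^ k) ^ 2)%N; last first.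
      by rewrite -expnM -expnD muln2; congr expn; lia.
    rewrite [(q ^ k.+1)%N]expnS subn1; move: (q) q1 => [|r] // _ /=.
    have : (0 < r.+1 ^ k)%N by rewrite expn_gt0.
    by move: (r.+1 ^ k)%N => K K0 wtZ ZN; rewrite mulnBr muln1 leq_subLR; nia.
  + by exists d'.
- by rewrite -nE; exact: code_dim_dual_systematic.
- have y0C : row j0 (row_mx (- (G2 m alpha d)^T) 1%:M) \in dual_code C.
    by rewrite /C dual_code_systematic rowE mem_code.
  have [|y Cy yn|d'' [d''min /andP[lo hi]]] := min_dist_exists (lo := 2) y0C.
  + apply/eqP => /rowP/(_ (rshift _ j0))/eqP.
    by rewrite mxE row_mxEr !mxE eqxx oner_eq0.
  (* Systematic coordinates are covered by the rows of the identity block, all others by the all-one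
     first row of [G2]. *)
  + apply: dual_wt_ge2 Cy yn => j.
    case: (fintype.splitP j) => l jl.
      have -> : j = lshift n l by exact: val_inj.
      exists (row l (G2' m alpha d)); first by rewrite rowE mem_code.
      by rewrite mxE row_mxEl mxE eqxx oner_neq0.
    have -> : j = rshift m.+1 l by exact: val_inj.
    exists (row 0 (G2' m alpha d)); first by rewrite rowE mem_code.
    by rewrite mxE row_mxEr mxE oner_neq0.
  exists d''; split=> //; rewrite lo (leq_trans hi) //.
  rewrite row_row_mx wt_row_mx row1; apply: (@leq_add _ _ 2 1).
    apply: (@leq_trans #|[set (0 : 'I_m.+1); inord 2]|); last first.
      by rewrite cards2; case: (_ != _).
    apply: subset_leq_card; apply/subsetP => l; rewrite !inE !mxE dj0 mulr0 raddf0 add0r.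
    rewrite oppr_eq0 -!val_eqE /= inordK ?(leqW m3) //.
    by case: (_ == 0%N) => //; case: (_ == 2%N); rewrite ?eqxx.
  apply: (@leq_trans #|[set j0]|); last by rewrite cards1.
  apply: subset_leq_card; apply/subsetP => l; rewrite !inE mxE eqxx /=.
  by case: (l == j0); rewrite ?eqxx.
Qed.
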